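(* Let $m \ge 2$ be even and $n \ge 4$ be even. The honeycomb toroidal graph $\mathrm{HTG}(m,n,0)$ is 2-spanning cyclable if and only if $n > 4$ or $(m,n) = (2,4)$.
   Context: For integers $m\ge 1$, $\ell\ge 0$ and $n\ge 4$ with $n$ even and $m-\ell$ even, the honeycomb toroidal graph $\mathrm{HTG}(m,n,\ell)$ is the simple graph with vertex set $\{u_{i,j}: 0\le i\le m-1,\ 0\le j\le n-1\}$ (first subscript computed modulo $m$, second modulo $n$) whose edge set is the set of the following unordered pairs: $\{u_{i,j},u_{i,j+1}\}$ for all $i,j$ (vertical edges); $\{u_{i,j},u_{i+1,j}\}$ for all $0\le i\le m-2$ with $i+j$ odd (flat edges); and $\{u_{m-1,j},u_{0,j+\ell}\}$ for all $j$ having the same parity as $m$ (and $\ell$) (jump edges). A 2-factor of a graph is a spanning subgraph in which every vertex has valency 2. A graph $X$ is 2-spanning cyclable if for every pair of distinct vertices $u,v$ of $X$ there is a 2-factor of $X$ consisting of exactly two cycles such that $u$ and $v$ lie in different cycles. *)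

(* Defs.v *)
From mathcomp Require Import all_boot.

Set Implicit Arguments.
Unset Strict Implicit.
Unset Printing Implicit Defensive.

(* Graphs on a finite vertex type are given by their adjacency relation. *)

Section TwoFactors.

Variable T : finType.
Implicit Types (e f : rel T) (c : seq T).

Definition simple_graph e : Prop := symmetric e /\ irreflexive e.

Definition valency e (x : T) : nat := #|[set y | e x y]|.

(* A spanning subgraph of [e] keeps all the vertices, so it amounts to a
   symmetric subrelation of [e]. *)
Definition two_factor e f : Prop :=
  [/\ symmetric f, subrel f e & forall x, valency f x = 2].

(* [c] lists the vertices of a cycle in cyclic order, and [cycle_edge c] is the
   adjacency relation of that cycle; fewer than three vertices would not give
   a cycle of a simple graph. *)
Definition is_cycle c : Prop := uniq c /\ 2 < size c.

Definition cycle_edge c : rel T :=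
  [rel x y | (x \in c) && ((y == next c x) || (y == prev c x))].

Definition consists_of_two_cycles f c1 c2 : Prop :=
  [/\ is_cycle c1, is_cycle c2, [disjoint c1 & c2]
    & forall x y, f x y = cycle_edge c1 x y || cycle_edge c2 x y].

Definition two_spanning_cyclable e : Prop :=
  forall u v : T, u != v ->
  exists f, two_factor e f /\
  exists c1 c2, [/\ consists_of_two_cycles f c1 c2, u \in c1 & v \in c2].

End TwoFactors.

(* The pair [(i, j)] stands for the vertex u_{i,j}.  The three relations below
   are oriented; [HTG] is the symmetric closure of their union. *)
Section HoneycombToroidal.

Variables m n l : nat.
Implicit Types x y : 'I_m * 'I_n.

Definition vertical_edge x y : bool :=
  (y.1 == x.1) && (y.2 == x.2.+1 %% n :> nat).

Definition flat_edge x y : bool :=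
  [&& y.1 == x.1.+1 :> nat, y.2 == x.2 & odd (x.1 + x.2)].

Definition jump_edge x y : bool :=
  [&& x.1.+1 == m, y.1 == 0 :> nat, y.2 == (x.2 + l) %% n :> nat
    & odd x.2 == odd m].

Definition HTG : rel ('I_m * 'I_n) :=
  [rel x y | [|| vertical_edge x y, flat_edge x y | jump_edge x y]
          || [|| vertical_edge y x, flat_edge y x | jump_edge y x]].

Lemma HTG_simple :
  0 < m -> 4 <= n -> ~~ odd n -> odd m = odd l -> simple_graph HTG.
Proof.
move=> m_gt0 n_ge4 nE mlE; split=> [x y|[i j]]; first by rewrite /HTG /= orbC.
rewrite /HTG /= orbb; apply/negbTE; rewrite !negb_or; apply/and3P; split.
- rewrite /vertical_edge /= eqxx /=; case: (ltnP j.+1 n).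
    by move=> lt_jn; rewrite modn_small // ltn_eqF.
  move=> le_nj; have -> : j.+1 = n by apply/eqP; rewrite eqn_leq le_nj andbT.
  rewrite modnn; apply/eqP=> j0.
  by move: (leq_trans n_ge4 le_nj); rewrite j0.
- by rewrite /flat_edge /= ltn_eqF.
rewrite /jump_edge /=; apply/negP=> /and4P[/eqP im /eqP i0 /eqP jE _].
have m1 : m = 1 by rewrite -im i0.
have : odd j = odd (j + l) by rewrite [in LHS]jE odd_mod //; apply/negbTE.
by rewrite oddD -mlE m1; case: odd.
Qed.

End HoneycombToroidal.

Arguments HTG m n l : clear implicits.

(* Main.v *)
Require Import Defs.
From mathcomp Require Import all_boot.
From mathcomp Require Import zify.

(* With l = 0 and m even the jump edges continue the flat ones, so HTG m n 0 is
   a brick wall on a torus.  For m = 2 it is a prism: two vertices in different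
   columns are separated by the two columns, two vertices in different rows by
   the block of two suitable consecutive rows and the complementary block.  For
   m >= 4 and n >= 6 the complement of a hexagon has a Hamiltonian cycle, and
   the three hexagons through a vertex u have only u in common, so one of them
   misses v.  Finally, for n = 4 and m >= 4, the ends u and v of a flat edge
   between columns C and D cannot be separated: that edge is unused, so the
   cycle of u contains the end in C of the other flat edge between C and D, and
   likewise for v and D.  The other flat edge is then unused too, hence the two
   cycles are C and D and miss a third column. *)

Set Implicit Arguments.
Unset Strict Implicit.
Unset Printing Implicit Defensive.

(** * Cycles as sequences, and 2-factors seen from a single vertex *)

Section TwoFactorTheory.

Variable T : finType.
Implicit Types (e f : rel T) (c : seq T).

(** A duplicate-free cycle is a single orbit of [next c], so iterating from [x] reaches all of
    it. *)
Lemma sub_next_closed (S : pred T) c x : uniq c -> x \in c -> S x ->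
  (forall y, S y -> S (next c y)) -> {in c, forall y, S y}.
Proof.
move=> c_uniq cx Sx S_next y cy.
have := fconnect_cycle (cycle_next c_uniq) cx y; rewrite cy => /iter_findex <-.
by elim: (findex _ _ _) => //= k IHk; apply: S_next.
Qed.

(** If the two coincided, the pair [x], [next c x] would be closed under [next c] and hence exhaust
    [c], which has more than two vertices. *)
Lemma next_neq_prev c x : is_cycle c -> x \in c -> next c x != prev c x.
Proof.
case=> c_uniq c_size cx; apply/eqP=> eq_np.
suff /(uniq_leq_size c_uniq) : {subset c <= [:: x; next c x]}.
  by rewrite leqNgt c_size.
pose S y := y \in [:: x; next c x].
apply: (@sub_next_closed S _ _ c_uniq cx); rewrite /S ?inE ?eqxx // => y.
rewrite !inE => /orP[] /eqP->; first by rewrite eqxx orbT.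
by rewrite eq_np next_prev // eqxx.
Qed.

Lemma cycle_edge_memr c x y : cycle_edge c x y -> y \in c.
Proof. by case/andP=> cx /orP[] /eqP->; rewrite (mem_next, mem_prev). Qed.

Lemma cycle_edge_sym c : uniq c -> symmetric (cycle_edge c).
Proof.
move=> c_uniq.
suff imp x y : cycle_edge c x y -> cycle_edge c y x.
  by move=> x y; apply/idP/idP; apply: imp.
move=> xy; apply/andP; split; first exact: cycle_edge_memr xy.
case/andP: xy => cx /orP[] /eqP->.
  by rewrite prev_next // eqxx orbT.
by rewrite next_prev // eqxx.
Qed.

Lemma sub_cycle_edge e c : symmetric e -> cycle e c -> subrel (cycle_edge c) e.
Proof.
move=> e_sym e_c x y /andP[cx /orP[] /eqP->]; first exact: next_cycle e_c cx.
by rewrite e_sym; apply: prev_cycle e_c cx.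
Qed.

Lemma two_cycles_factor e c1 c2 : symmetric e ->
    cycle e c1 -> cycle e c2 -> 2 < size c1 -> 2 < size c2 ->
    uniq (c1 ++ c2) -> (forall x, x \in c1 ++ c2) ->
  exists f, two_factor e f /\ consists_of_two_cycles f c1 c2.
Proof.
move=> e_sym e_c1 e_c2 c1_size c2_size.
rewrite cat_uniq => /and3P[c1_uniq /hasPn c12 c2_uniq] cov.
have nc1 x : x \in c2 -> (x \in c1) = false by move/c12/negbTE.
exists [rel x y | cycle_edge c1 x y || cycle_edge c2 x y].
split; last first.
  split=> //; rewrite disjoint_sym disjoint_has; apply/hasPn=> x /c12 //.
split.
- by move=> x y; congr (_ || _); apply: cycle_edge_sym.
- by move=> x y /orP[]; apply: sub_cycle_edge.
have card_nbr c x : is_cycle c -> x \in c ->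
    #|[set y | (y == next c x) || (y == prev c x)]| = 2.
  move=> cc cx; have -> : [set y | (y == next c x) || (y == prev c x)]
     = [set next c x; prev c x] by apply/setP=> y; rewrite !inE.
  by rewrite cards2 next_neq_prev.
move=> x; rewrite /valency /cycle_edge /=; have := cov x; rewrite mem_cat.
case: (boolP (x \in c1)) => [c1x _|_ /= c2x].
  have -> : (x \in c2) = false by apply/negP=> c2x; rewrite nc1 in c1x.
  under eq_finset => y do rewrite orbF.
  by rewrite card_nbr.
by rewrite c2x; apply: card_nbr.
Qed.

Section SeparatedFactor.

Variables (f : rel T) (c1 c2 : seq T).
Hypothesis fc : consists_of_two_cycles f c1 c2.

Lemma two_cycles_closed1 x y : f x y -> x \in c1 -> y \in c1.
Proof.
case: fc => _ _ /disjointFr dis ->; case/orP; first by move/cycle_edge_memr.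
by case/andP=> c2x _ /dis; rewrite c2x.
Qed.

Lemma two_cycles_closed2 x y : f x y -> x \in c2 -> y \in c2.
Proof.
case: fc => _ _ /disjointFr dis ->; case/orP; last by move/cycle_edge_memr.
by case/andP=> /dis-> _.
Qed.

(** Successive vertices of [c1] are [f]-adjacent, so a property that passes along [f] travels around
    the whole cycle. *)
Lemma two_cycles_sub1 (S : pred T) x : x \in c1 -> S x ->
  (forall y z, S y -> f y z -> S z) -> {in c1, forall y, S y}.
Proof.
case: fc => -[c1_uniq _] _ _ fE c1x Sx S_f y c1y.
pose S' z := S z && (z \in c1).
have S'x : S' x by rewrite /S' Sx.
have S'_next z : S' z -> S' (next c1 z).
  case/andP=> Sz c1z; rewrite /S' mem_next c1z andbT.
  by apply: S_f Sz _; rewrite fE /cycle_edge /= c1z eqxx.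
by have /andP[] := sub_next_closed c1_uniq c1x S'x S'_next c1y.
Qed.

End SeparatedFactor.

Lemma two_cyclesC f c1 c2 :
  consists_of_two_cycles f c1 c2 -> consists_of_two_cycles f c2 c1.
Proof.
case=> cc1 cc2 dis fE; split=> //; first by rewrite disjoint_sym.
by move=> x y; rewrite fE orbC.
Qed.

Section Valency2.

Variables (e f : rel T) (x a b d : T).
Hypothesis ef : two_factor e f.
Hypothesis nbr : forall y, e x y -> y \in [:: a; b; d].

Lemma two_factor_card : #|[set y | f x y]| = 2.
Proof. by case: ef => _ _ /(_ x). Qed.

(** Two [f]-neighbours must be found among [a], [b], [d]; excluding [d] leaves no choice. *)
Lemma two_factor_unused : ~~ f x d -> f x a && f x b.
Proof.
move=> nfd; have sub : [set y | f x y] \subset [set a; b].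
  apply/subsetP=> y; rewrite !inE => fxy.
  have [_ /(_ _ _ fxy)/nbr + _] := ef; rewrite !inE orbA => /orP[] // /eqP yd.
  by rewrite -yd fxy in nfd.
have /eqP eq_ab : [set y | f x y] == [set a; b].
  by rewrite eqEcard sub two_factor_card cards2; case: (_ != _).
have: (a \in [set a; b]) && (b \in [set a; b]) by rewrite !inE !eqxx orbT.
by rewrite -eq_ab !inE.
Qed.

Lemma two_factor_one_of_two : f x a || f x b.
Proof.
apply/negPn/negP; rewrite negb_or => /andP[nfa nfb].
have: [set y | f x y] \subset [set d].
  apply/subsetP=> y; rewrite !inE => fxy.
  have [_ /(_ _ _ fxy)/nbr + _] := ef; rewrite !inE => /or3P[] // /eqP yE.
    by rewrite -yE fxy in nfa.
  by rewrite -yE fxy in nfb.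
by move/subset_leq_card; rewrite two_factor_card cards1.
Qed.

End Valency2.

Lemma two_factor_mem2 e f x a b y :
  two_factor e f -> a != b -> f x a -> f x b -> f x y -> y \in [:: a; b].
Proof.
move=> ef ab fa fb fy.
have sub : [set a; b] \subset [set y | f x y].
  by apply/subsetP=> z; rewrite !inE => /orP[] /eqP->.
have: y \in [set y | f x y] by rewrite inE.
suff /eqP <- : [set a; b] == [set y | f x y] by rewrite !inE.
by rewrite eqEcard sub (two_factor_card _ ef) cards2 ab.
Qed.

End TwoFactorTheory.

(* A quadrant of the brick wall that covers the torus; closed walks of HTG m n 0
   come from walks of [brick] whose ends have the same image under [place]. *)
Definition brick_edge (p q : nat * nat) : bool :=
  (q == (p.1, p.2.+1)) || odd (p.1 + p.2) && (q == (p.1.+1, p.2)).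

Definition brick : rel (nat * nat) :=
  [rel p q | brick_edge p q || brick_edge q p].

Lemma brick_vertical i j : brick (i, j) (i, j.+1).
Proof. by rewrite /brick /brick_edge /= eqxx. Qed.

Lemma brick_flat i j : odd (i + j) -> brick (i, j) (i.+1, j).
Proof. by move=> ij; rewrite /brick /brick_edge /= ij eqxx orbT. Qed.

Lemma brick_sym : symmetric brick.
Proof. by move=> p q; rewrite /brick /= orbC. Qed.

(** * Vertical runs and the serpentine walks built from them *)

Definition up (i a k : nat) := [seq (i, j) | j <- iota a k].
Definition down (i a k : nat) := rev (up i a k).

Arguments up : simpl never.
Arguments down : simpl never.

Lemma upS i a k : up i a k.+1 = (i, a) :: up i a.+1 k.
Proof. by []. Qed.

Lemma downS i a k : down i a k.+1 = (i, a + k) :: down i a k.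
Proof. by rewrite /down /up -addn1 iotaD map_cat rev_cat. Qed.

Lemma size_up i a k : size (up i a k) = k.
Proof. by rewrite size_map size_iota. Qed.

Lemma size_down i a k : size (down i a k) = k.
Proof. by rewrite size_rev size_up. Qed.

Lemma mem_up i a k p : (p \in up i a k) = (p.1 == i) && (a <= p.2 < a + k).
Proof.
case: p => i' j; apply/mapP/andP => /= [[j' + [-> ->]]|[/eqP-> aj]].
  by rewrite mem_iota eqxx.
by exists j; rewrite ?mem_iota.
Qed.

Lemma mem_down i a k p : (p \in down i a k) = (p.1 == i) && (a <= p.2 < a + k).
Proof. by rewrite mem_rev mem_up. Qed.

Lemma path_up i a k p : brick p (i, a) -> path brick p (up i a k).
Proof.
elim: k a p => // k IHk a p pa; rewrite upS /= pa IHk //.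
exact: brick_vertical.
Qed.

Lemma last_up i a k p : last p (up i a k.+1) = (i, a + k).
Proof.
elim: k a p => [|k IHk] a p; first by rewrite /= addn0.
by rewrite upS [LHS]/= -[LHS]/(last (i, a) (up i a.+1 k.+1)) IHk addSnnS.
Qed.

Lemma path_down i a k p : brick p (i, a + k.-1) -> path brick p (down i a k).
Proof.
elim: k p => // k IHk p pa; rewrite downS /= pa /=.
case: k IHk {pa} => // k IHk; apply: IHk.
by rewrite addnS brick_sym brick_vertical.
Qed.

Lemma last_down i a k p : last p (down i a k.+1) = (i, a).
Proof. by rewrite /down upS rev_cons last_rcons. Qed.

(* The Hamiltonian cycle of the complement of the hexagon in the rows 0, 1, 2 of
   the columns m - 1 and m (that is, 0), for m = 2k + 2: from (0, 3), [low k]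
   sweeps the rows 0..3 of the columns 1..2k, which leads to (2k + 1, 3); then
   [high (n - 4) k.+1] sweeps the rows 4..n-1 of all columns, from the last one
   back to column 0. *)
Fixpoint low k : seq (nat * nat) :=
  if k is k'.+1 then low k' ++ down (k'.*2).+1 0 4 ++ up k.*2 0 4 else [::].

Fixpoint high h k : seq (nat * nat) :=
  if k is k'.+1 then up (k'.*2).+1 4 h ++ down k'.*2 4 h ++ high h k'
  else [::].

Lemma lowS k :
  low k.+1 = low k ++ down (k.*2).+1 0 4 ++ up (k.*2).+2 0 4.
Proof. by []. Qed.

Lemma highS h k :
  high h k.+1 = up (k.*2).+1 4 h ++ down k.*2 4 h ++ high h k.
Proof. by []. Qed.

Lemma size_low k : size (low k) = 8 * k.
Proof.
by elim: k => // k IHk; rewrite lowS !size_cat size_up size_down IHk; lia.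
Qed.

Lemma size_high h k : size (high h k) = h * k.*2.
Proof.
elim: k => [|k IHk]; first by rewrite muln0.
by rewrite highS !size_cat size_up size_down IHk; lia.
Qed.

Lemma mem_low k p : (p \in low k) = (0 < p.1 <= k.*2) && (p.2 < 4).
Proof.
elim: k => [|k IHk]; first by rewrite /= in_nil; lia.
rewrite lowS !mem_cat IHk mem_up mem_down; lia.
Qed.

Lemma mem_high h k p : (p \in high h k) = (p.1 < k.*2) && (4 <= p.2 < 4 + h).
Proof.
elim: k => [|k IHk]; first by rewrite /= in_nil; lia.
rewrite highS !mem_cat IHk mem_up mem_down; lia.
Qed.

(** Flat edges go right from an even column in odd rows and from an odd column in even rows, so the
    sweep can change columns alternately in row 3 and row 0. *)
Lemma path_low k : path brick (0, 3) (low k) /\ last (0, 3) (low k) = (k.*2, 3).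
Proof.
elim: k => // k [IHp IHl]; rewrite lowS !cat_path !last_cat IHl.
rewrite last_down last_up IHp path_down; last by apply: brick_flat; lia.
by rewrite path_up //; apply: brick_flat; lia.
Qed.

(** Since the height [h.+2] is even, the top row [h + 5] is odd and joins columns [2k + 1] and [2k];
    row 4, being even, joins column [2k] to column [2k - 1]. The sweep turns left in these two
    rows. *)
Lemma path_high h k p : odd h = false -> brick p ((k.*2).+1, 4) ->
  path brick p (high h.+2 k.+1) /\ last p (high h.+2 k.+1) = (0, 4).
Proof.
move=> h_even; elim: k p => [|k IHk] p pk.
  rewrite highS [high _ 0]/= cats0 cat_path last_cat last_up last_down.
  rewrite path_up // path_down // brick_sym.
  by rewrite -addSnnS addSn; apply: brick_flat; lia.
have q_brick : brick (k.+1.*2, 4) ((k.*2).+1, 4).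
  by rewrite brick_sym; apply: brick_flat; lia.
have:= IHk _ q_brick; rewrite (highS _ k.+1).
move: (high _ k.+1) => s [s_path s_last].
rewrite !cat_path !last_cat last_up last_down path_up // path_down //.
by rewrite brick_sym /= -addSnnS addSn; apply: brick_flat; lia.
Qed.

(** * Cyclic intervals of residues *)

Lemma modn_succ k d : (k %% d).+1 %% d = k.+1 %% d.
Proof. by rewrite -addn1 modnDml addn1. Qed.

Definition arc n b h := [seq (b + k) %% n | k <- iota 0 h].

Lemma arcP n b h z :
  reflect (exists2 k, k < h & z = (b + k) %% n) (z \in arc n b h).
Proof.
apply: (iffP mapP) => -[k]; first by rewrite mem_iota; exists k.
by exists k; rewrite ?mem_iota.
Qed.

(** Adding [n - h.-1] moves back by [h - 1] modulo [n]: one arc starts at [y], the other ends there.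
    Together they span [2h - 1] residues, too few to overlap again around the circle. *)
Lemma arc_meet n y h z : y < n -> h.*2 <= n.+1 ->
  z \in arc n y h -> z \in arc n (y + (n - h.-1)) h -> z = y.
Proof.
move=> yn hn /arcP[s sh ->] /arcP[t th].
move/eqP; rewrite -addnA eqn_modDl modn_small; last by lia.
have [th1|th1] := ltnP t h.-1; first by rewrite modn_small; lia.
have -> : n - h.-1 + t = n by lia.
by rewrite modnn => /eqP->; rewrite addn0 modn_small.
Qed.

(** * Wrapping the brick wall onto the torus *)

Section Torus.

Variables m n : nat.
Hypotheses (m_gt0 : 0 < m) (m_even : ~~ odd m).
Hypotheses (n_gt0 : 0 < n) (n_even : ~~ odd n).
Notation T := ('I_m * 'I_n)%type.
Implicit Types (x y u v : T) (p q : nat * nat).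

Definition separable u v : Prop :=
  exists f, two_factor (HTG m n 0) f /\
  exists c1 c2, [/\ consists_of_two_cycles f c1 c2, u \in c1 & v \in c2].

Definition flat0_edge x y : bool :=
  [&& y.1 == x.1.+1 %% m :> nat, y.2 == x.2 & odd (x.1 + x.2)].

(** As [m] is even, the last column [m - 1] is odd, so the even rows of the jump edges are those
    where [i + j] is odd: a jump edge is a flat edge with the column taken modulo [m]. *)
Lemma HTG0E x y : HTG m n 0 x y =
  (vertical_edge x y || flat0_edge x y) ||
  (vertical_edge y x || flat0_edge y x).
Proof.
suff flatE u v : flat_edge u v || jump_edge 0 u v = flat0_edge u v.
  by rewrite /HTG /= !flatE.
case: u v => [i j] [i' j']; rewrite /flat_edge /jump_edge /flat0_edge /=.
rewrite addn0 (modn_small (ltn_ord j)) val_eqE (negbTE m_even) oddD.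
have [i1m|mi] := ltnP i.+1 m.
  by rewrite modn_small // (ltn_eqF i1m) /= orbF.
have i1m : i.+1 = m by apply/eqP; rewrite eqn_leq mi ltn_ord.
rewrite i1m modnn (ltn_eqF (ltn_ord i')) eqxx /=; congr [&& _, _ & _].
have -> : odd i by rewrite -[odd i]negbK -[~~ odd i]/(odd i.+1) i1m.
by case: (odd j).
Qed.

Definition place a b p : T :=
  (Ordinal (ltn_pmod (a + p.1) m_gt0), Ordinal (ltn_pmod (b + p.2) n_gt0)).

Lemma place_surj a b x :
  exists i j, [/\ i < m, j < n & x = place a b (i, j)].
Proof.
(* Here [k * d.-1] serves as [-k] modulo [d]. *)
have surj d k z : 0 < d -> z < d -> (k + (z + k * d.-1) %% d) %% d = z.
  move=> d0 zd; rewrite modnDmr addnCA -mulnS prednK // addnC modnMDl.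
  exact: modn_small.
exists ((x.1 + a * m.-1) %% m), ((x.2 + b * n.-1) %% n).
split; rewrite ?ltn_mod //.
by rewrite [LHS]surjective_pairing; congr pair; apply: val_inj; rewrite /= surj.
Qed.

(** Reduction modulo the even numbers [m] and [n] preserves parities, and a shift by [a], [b] of
    equal parity preserves that of the coordinate sum, which governs flat edges. *)
Lemma place_brick a b p q : odd a = odd b -> brick p q ->
  HTG m n 0 (place a b p) (place a b q).
Proof.
move=> ab; rewrite HTG0E.
set e := fun x y => vertical_edge x y || flat0_edge x y.
suff imp p' q' : brick_edge p' q' -> e (place a b p') (place a b q').
  by case/orP=> /imp E; apply/orP; [left|right].
rewrite /brick_edge /e; case/orP=> [/eqP->|/andP[p_odd /eqP->]]; apply/orP.
  by left; rewrite /vertical_edge /= addnS modn_succ !eqxx.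
right; rewrite /flat0_edge /= eqxx oddD.
rewrite !odd_mod ?(negbTE m_even) ?(negbTE n_even) //.
rewrite addnS modn_succ eqxx /= !oddD ab.
by move: p_odd; rewrite oddD; case: (odd b); case: (odd _); case: (odd _).
Qed.

Lemma HTG0_sym : symmetric (HTG m n 0).
Proof. by move=> x y; rewrite !HTG0E orbC. Qed.

(** Covering all [m * n] vertices with total length [m * n] forces the listed vertices to be
    distinct, so simplicity and disjointness of the cycles need no separate check. Each start [p1],
    [p2] is counted only through the last entry of its walk. *)
Lemma separate_by_walks a b p1 p2 s1 s2 u v : odd a = odd b ->
    path brick p1 s1 -> place a b (last p1 s1) = place a b p1 -> 2 < size s1 ->
    path brick p2 s2 -> place a b (last p2 s2) = place a b p2 -> 2 < size s2 ->
    size s1 + size s2 = m * n ->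
    (forall x, x \in map (place a b) (s1 ++ s2)) ->
    u \in map (place a b) s1 -> v \notin map (place a b) s1 ->
  separable u v.
Proof.
move=> ab path1 last1 size1 path2 last2 size2 size12 cov us1 vs1.
have closed p s : path brick p s -> place a b (last p s) = place a b p ->
    cycle (HTG m n 0) (map (place a b) s).
  move=> s_path s_last; rewrite (cycle_path (place a b p)) last_map s_last.
  by apply: homo_path s_path => x y; apply: place_brick.
have [||||||f [ef fc]] :=
  @two_cycles_factor _ (HTG m n 0)
    (map (place a b) s1) (map (place a b) s2) HTG0_sym;
  rewrite -?map_cat ?size_map //.
- exact: closed path1 last1.
- exact: closed path2 last2.
- apply: (@leq_size_uniq _ (enum {: T})) => [|x _|]; rewrite ?enum_uniq //.
  by rewrite size_map size_cat size12 -cardE card_prod !card_ord.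
exists f; split=> //; exists (map (place a b) s1), (map (place a b) s2).
split=> //; have := cov v; rewrite map_cat mem_cat (negbTE vs1).
exact: id.
Qed.

Lemma place_eq a b p q : a + p.1 = a + q.1 %[mod m] ->
  b + p.2 = b + q.2 %[mod n] -> place a b p = place a b q.
Proof. by move=> E1 E2; congr pair; apply: val_inj. Qed.

Lemma eq_place a b p x :
  x.1 = (a + p.1) %% m :> nat -> x.2 = (b + p.2) %% n :> nat ->
  x = place a b p.
Proof.
by case: x => i j /= E1 E2; congr pair; apply: val_inj; rewrite /= (E1, E2).
Qed.

(** * A hexagon against its complement, for at least four columns and six rows *)

Lemma hexagon_separates a b u v : 3 < m -> 5 < n -> odd (a + b) ->
    val u.1 \in arc m a 2 -> val u.2 \in arc n b 3 ->
    ~~ ((val v.1 \in arc m a 2) && (val v.2 \in arc n b 3)) ->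
  separable u v.
Proof.
move=> m_gt3 n_gt5 ab /arcP[k k2 u1] /arcP[l l3 u2] nv.
have [k' mE] : exists k', m = k'.*2.+2.
  by exists (m - 2)./2; rewrite -[in LHS](odd_double_half m); lia.
have [h nE] : exists h, n = h.+2 + 4 by exists (n - 6); lia.
have mS : m.-1.+1 = m by rewrite prednK.
(* Coordinates are relative to the shift [(a.+1, b)], which sends columns [m.-1] and [m] to [a] and
   [a + 1] modulo [m]; the height [h.+2] below is [n - 4]. *)
pose s1 := [:: (m.-1, 1); (m.-1, 2); (m, 2); (m, 1); (m, 0); (m.-1, 0)].
pose s2 := low k' ++ (k'.*2.+1, 3) :: high h.+2 k'.+1 ++ [:: (0, 3)].
have s1P p : p \in s1 = (m.-1 <= p.1 <= m) && (p.2 < 3).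
  case: p => i j; rewrite /s1 !inE !xpair_eqE /=; lia.
apply: (@separate_by_walks a.+1 b (m.-1, 0) (0, 3) s1 s2) => //.
- by move: ab; rewrite oddD /=; case: (odd a); case: (odd b).
- have flat j : ~~ odd j -> brick (m.-1, j) (m, j).
    by move=> j_even; rewrite -[in X in brick _ X]mS brick_flat //; lia.
  rewrite /s1 /= !brick_vertical flat // [brick (m, 0) _]brick_sym.
  rewrite [brick (m, 1) _]brick_sym [brick (m, 2) _]brick_sym.
  by rewrite !brick_vertical flat.
- have [low_path low_last] := path_low k'.
  have [||high_path high_last] := @path_high h k' (k'.*2.+1, 3).
  - by lia.
  - exact: brick_vertical.
  rewrite /s2; move: (high _ _) high_path high_last => t t_path t_last.
  rewrite cat_path low_path low_last /= cat_path t_path t_last /=.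
  by rewrite andbT; apply: brick_flat; lia.
- by rewrite /s2 last_cat /= last_cat.
- by rewrite /s2 size_cat size_low; lia.
- rewrite /s2; move: (high _ _) (size_high h.+2 k'.+1) => t t_size.
  by rewrite size_cat /= size_cat size_low /= t_size mE nE; lia.
- move=> x; have [i [j [im jn ->]]] := place_surj a.+1 b x.
  (* The part of column 0 below row 3 occurs in the walks as column [m], inside the hexagon. *)
  have [/andP[/eqP i0 j3]|ij] := boolP ((i == 0) && (j < 3)).
    have -> : place a.+1 b (i, j) = place a.+1 b (m, j).
      by apply: place_eq; rewrite //= i0 addn0 modnDr.
    by apply: map_f; rewrite mem_cat s1P /=; lia.
  apply: map_f; rewrite !mem_cat s1P inE mem_cat mem_low mem_high inE.
  by rewrite !xpair_eqE /=; lia.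
- have -> : u = place a.+1 b (m.-1 + k, l).
    by apply: eq_place; rewrite //= u1 addSnnS -addSn mS addnCA modnDl.
  by apply: map_f; rewrite s1P /=; lia.
apply: contra nv => /mapP[[i j]]; rewrite s1P /= => /andP[im j3] ->.
apply/andP; split; apply/arcP; last by exists j.
exists (i - m.-1); rewrite /=; first by lia.
have -> : a.+1 + i = m + (a + (i - m.-1)) by lia.
by rewrite modnDl.
Qed.

Lemma separable_ge6 u v : 3 < m -> 5 < n -> u != v -> separable u v.
Proof.
move=> m_gt3 n_gt5; case: u v => x y [x' y'] uv.
have hex a b : odd (a + b) -> val x \in arc m a 2 -> val y \in arc n b 3 ->
    separable (x, y) (x', y') \/
    (val x' \in arc m a 2) && (val y' \in arc n b 3).
  move=> ab xa yb; have [|out] := boolP (_ && _); first by right.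
  by left; apply: (@hexagon_separates a b).
have bottom k d (z : 'I_k) : 0 < d -> val z \in arc k z d.
  by move=> d0; apply/arcP; exists 0; rewrite ?addn0 ?modn_small.
have top k d (z : 'I_k) : 0 < d <= k -> val z \in arc k (z + (k - d.-1)) d.
  move=> d0; apply/arcP; exists d.-1; first by lia.
  have -> : z + (k - d.-1) + d.-1 = z + k by lia.
  by rewrite modnDr modn_small.
have mid : val y \in arc n (y + n.-1) 3.
  apply/arcP; exists 1 => //; rewrite -addnA addn1 prednK //.
  by rewrite modnDr modn_small.
(* [a1] is the left column of the two hexagons having [u] in their bottom or top row, [a2] that of
   the hexagon having [u] in its middle row; [x + (m - 1)] stands for [x - 1] modulo [m]. *)
pose a1 : nat := if odd (x + y) then x : nat else x + (m - 1).
pose a2 : nat := if odd (x + y) then x + (m - 1) else x.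
have [a1x a2x] : val x \in arc m a1 2 /\ val x \in arc m a2 2.
  by rewrite /a1 /a2; case: ifP => _; split;
    rewrite ?bottom ?(@top _ 2) //; lia.
have [//|/andP[x1 y1]] : separable (x, y) (x', y') \/
    (val x' \in arc m a1 2) && (val y' \in arc n y 3).
  by apply: hex => //; [rewrite /a1; case: ifP; lia|apply: bottom].
have [//|/andP[_ y2]] : separable (x, y) (x', y') \/
    (val x' \in arc m a1 2) && (val y' \in arc n (y + (n - 2)) 3).
  by apply: hex => //; [rewrite /a1; case: ifP; lia|apply: (@top _ 3); lia].
have [//|/andP[x2 _]] : separable (x, y) (x', y') \/
    (val x' \in arc m a2 2) && (val y' \in arc n (y + n.-1) 3).
  by apply: hex => //; rewrite /a2; case: ifP; lia.
(* The bottom-row and top-row hexagons share only row [y]; the column pairs at [a1] and [a2] share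
   only column [x]. *)
case/eqP: uv; congr pair; apply/val_inj/esym;
  last by apply: arc_meet y1 y2; rewrite //; lia.
suff [z1 z2] : val x' \in arc m x 2 /\ val x' \in arc m (x + (m - 1)) 2.
  by apply: arc_meet z1 z2; rewrite //; lia.
by move: x1 x2; rewrite /a1 /a2; case: ifP.
Qed.

(** * The prism: two columns *)

(** Rows [b] and [b + 1] carry a 4-cycle; the other rows carry a cycle going up one column and down
    the other. In both walks column 2 is column 0 again. Shifting both coordinates by [b] respects
    parity for every [b], at worst swapping the columns. *)
Lemma block_separates b u v : m = 2 -> 3 < n ->
  val u.2 \in arc n b 2 -> val v.2 \notin arc n b 2 -> separable u v.
Proof.
move=> m2 n_gt3 /arcP[l l2 u2] nv.
have [h nE] : exists h, n = h + 4 by exists (n - 4); lia.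
pose s1 := [:: (0, 1); (1, 1); (1, 0); (2, 0)].
pose s2 := up 0 3 h.+1 ++ down 1 2 h.+2 ++ [:: (2, 2)].
have inS x k : x.2 = (b + k) %% n :> nat -> k < 2 -> x \in map (place b b) s1.
  move=> xk k2; have [i [j [im jn xE]]] := place_surj b b x.
  pose i' := if (i == 0) && (k == 0) then 2 else i.
  have -> : x = place b b (i', k).
    apply: eq_place => //=; rewrite xE /i' /=; case: ifP => // /andP[/eqP-> _].
    by rewrite addn0 -m2 modnDr.
  apply: map_f; rewrite /s1 !inE !xpair_eqE /i'; case: ifP; lia.
apply: (@separate_by_walks b b (0, 0) (0, 2) s1 s2) => //.
- by apply: place_eq; rewrite //= addn0 -m2 modnDr.
- rewrite /s2 !cat_path path_up ?brick_vertical // last_up.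
  by rewrite path_down ?last_down //=; apply: brick_flat; lia.
- rewrite /s2 !last_cat /=; apply: place_eq; rewrite //= addn0.
  by rewrite -[X in _ + X]m2 modnDr.
- by rewrite /s2 !size_cat size_up size_down /=; lia.
- by rewrite /s2 !size_cat size_up size_down /= m2 nE; lia.
- move=> x; have [i [j [im jn xE]]] := place_surj b b x.
  rewrite map_cat mem_cat.
  have [j2|j2] := ltnP j 2; first by rewrite (@inS x j) // xE.
  rewrite orbC xE.
  have [/andP[/eqP-> /eqP->]|ij] := boolP ((i == 0) && (j == 2)).
    have -> : place b b (0, 2) = place b b (2, 2).
      by apply: place_eq; rewrite //= addn0 -[X in _ + X]m2 modnDr.
    by rewrite map_f // /s2 !mem_cat mem_head !orbT.
  rewrite map_f // /s2 !mem_cat mem_up mem_down inE xpair_eqE /=; lia.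
- exact: inS u2 l2.
apply: contra nv => /mapP[[i j] s1j ->]; apply/arcP; exists j => //.
by move: s1j; rewrite /s1 !inE !xpair_eqE; lia.
Qed.

Lemma columns_separate u v : m = 2 -> 3 < n -> u.1 != v.1 -> separable u v.
Proof.
move=> m2 n_gt3 uv; pose s i := up i 1 n.
have col i : path brick (i, 0) (s i) /\
    place 0 0 (last (i, 0) (s i)) = place 0 0 (i, 0).
  split; first by apply: path_up; apply: brick_vertical.
  have -> : last (i, 0) (s i) = (i, n).
    by rewrite /s -(prednK n_gt0) last_up add1n.
  by apply: place_eq; rewrite //= addn0 modnDr.
have inS (x : T) : x \in map (place 0 0) (s x.1).
  (* The row offset 1 gives representatives in rows 1 to [n], as listed by [up i 1 n]. *)
  have [i [j [im jn xE]]] := place_surj 0 1 x.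
  have xE' : x = place 0 0 (val x.1, j.+1).
    apply: eq_place; last by rewrite [in LHS]xE.
    by rewrite /= modn_small ?add0n.
  by rewrite [X in X \in _]xE'; apply: map_f; rewrite mem_up eqxx /=; lia.
have [pu lu] := col u.1; have [pv lv] := col v.1.
apply: (separate_by_walks _ pu lu _ pv lv) => //.
- by rewrite size_up; lia.
- by rewrite size_up; lia.
- by rewrite !size_up m2; lia.
- move=> x; rewrite map_cat mem_cat.
  have [xu|xu] := eqVneq x.1 u.1; first by rewrite -xu inS.
  suff <- : x.1 = v.1 by rewrite inS orbT.
  apply/eqP; move: uv xu; rewrite -!val_eqE /=.
  by move: (ltn_ord u.1) (ltn_ord v.1) (ltn_ord x.1); lia.
apply/negP=> /mapP[[i j]]; rewrite mem_up /= => /andP[/eqP-> _].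
move/(congr1 (fun x : T => val x.1)) => /= vu.
by move: uv; rewrite -val_eqE /= vu add0n modn_small ?eqxx.
Qed.

Lemma separable_prism u v : m = 2 -> 3 < n -> u != v -> separable u v.
Proof.
move=> m2 n_gt3 uv.
have [uv2|] := eqVneq u.2 v.2.
  apply: columns_separate => //; apply: contra uv => /eqP uv1.
  by rewrite [u]surjective_pairing [v]surjective_pairing uv1 uv2.
(* The blocks with the row of [u] as lower and as upper row share only that row, so one of them
   misses [v]. *)
move=> uv2; have [v0|v0] := boolP (val v.2 \in arc n u.2 2); last first.
  apply: block_separates v0 => //.
  by apply/arcP; exists 0; rewrite ?addn0 ?modn_small.
have [v1|v1] := boolP (val v.2 \in arc n (u.2 + (n - 1)) 2); last first.
  apply: block_separates v1 => //.
  by apply/arcP; exists 1; rewrite // -addnA subnK // modnDr modn_small.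
by case/eqP: uv2; apply/esym/val_inj; apply: arc_meet v0 v1; rewrite //; lia.
Qed.

End Torus.

(** * Four rows: the obstruction when there are more than two columns *)

Section FourRows.

Variable m : nat.
Hypotheses (m_even : ~~ odd m).
Notation T := ('I_m * 'I_4)%type.
Implicit Types (i : 'I_m) (k : 'I_4) (x y : T).

Definition row4 j : 'I_4 := inord j.

(** With four rows, rows 1 and 3 have the same vertical neighbours, rows 0 and 2; the obstruction
    rests on this coincidence. *)
Lemma vertical_odd_row i k y : odd k ->
  vertical_edge (i, k) y || vertical_edge y (i, k) ->
  y \in [:: (i, row4 0); (i, row4 2)].
Proof.
case: y => i' k'; rewrite /vertical_edge /= !inE !xpair_eqE.
rewrite -!(inj_eq val_inj k') /= !inordK // => k_odd.
case/orP=> /andP[/eqP-> /eqP kk']; rewrite eqxx /=.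
  by case: k k' k_odd kk' => [[|[|[|[|]]]]] //= _ [[|[|[|[|]]]]].
by case: k k' k_odd kk' => [[|[|[|[|]]]]] //= _ [[|[|[|[|]]]]].
Qed.

Section Column.

Variables (f : rel T) (i i' : 'I_m).
Hypothesis ef : two_factor (HTG m 4 0) f.
Hypothesis ii' : forall k y, odd k ->
  flat0_edge (i, k) y || flat0_edge y (i, k) -> y = (i', k).

Lemma odd_row_nbr k y : odd k -> HTG m 4 0 (i, k) y ->
  y \in [:: (i, row4 0); (i, row4 2); (i', k)].
Proof.
move=> k_odd; rewrite HTG0E // orbACA => /orP[/vertical_odd_row|/ii' ->] //.
  by rewrite !inE => /(_ k_odd) /orP[] ->; rewrite ?orbT.
by rewrite !inE eqxx !orbT.
Qed.

(** Without its flat edge, the vertex in row 1 is joined to rows 0 and 2 of its column, and the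
    vertex in row 3 must use at least one of the same two vertices. *)
Lemma unused_flat_column (c : seq T) :
  (forall x y, f x y -> x \in c -> y \in c) ->
  ~~ f (i, row4 1) (i', row4 1) -> (i, row4 1) \in c -> (i, row4 3) \in c.
Proof.
move=> c_closed nf c1; have [f_sym _ _] := ef.
have r1 : odd (row4 1) by rewrite inordK.
have r3 : odd (row4 3) by rewrite inordK.
have /andP[f0 f2] := two_factor_unused ef (@odd_row_nbr _ ^~ r1) nf.
have := two_factor_one_of_two ef (@odd_row_nbr _ ^~ r3).
rewrite f_sym [f _ (i, row4 2)]f_sym.
by case/orP=> /c_closed; apply; [apply: c_closed f0 _|apply: c_closed f2 _].
Qed.

(** Both odd-row vertices are then joined to rows 0 and 2, which saturates these as well: the column
    becomes a 4-cycle with no exit. *)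
Lemma unused_flats_column : ~~ f (i, row4 1) (i', row4 1) ->
  ~~ f (i, row4 3) (i', row4 3) -> forall x y, x.1 == i -> f x y -> y.1 == i.
Proof.
move=> nf1 nf3; have [f_sym _ _] := ef.
have r1 : odd (row4 1) by rewrite inordK.
have r3 : odd (row4 3) by rewrite inordK.
have /andP[f10 f12] := two_factor_unused ef (@odd_row_nbr _ ^~ r1) nf1.
have /andP[f30 f32] := two_factor_unused ef (@odd_row_nbr _ ^~ r3) nf3.
have use a b x y : a != b -> f x (i, a) -> f x (i, b) -> f x y -> y.1 == i.
  move=> ab fa fb fy.
  have ab' : (i, a) != (i, b) by rewrite xpair_eqE eqxx.
  by have := two_factor_mem2 ef ab' fa fb fy; rewrite !inE => /orP[] /eqP->.
case=> _ k y /eqP /= ->.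
have: k \in [:: row4 0; row4 1; row4 2; row4 3].
  rewrite !inE -!(inj_eq val_inj k) /= !inordK //.
  by case: k => [[|[|[|[|]]]]].
rewrite !inE => /or4P[] /eqP->.
- by apply: (use (row4 1) (row4 3)); rewrite 1?f_sym // -val_eqE /= !inordK.
- by apply: (use (row4 0) (row4 2)); rewrite // -val_eqE /= !inordK.
- by apply: (use (row4 1) (row4 3)); rewrite 1?f_sym // -val_eqE /= !inordK.
- by apply: (use (row4 0) (row4 2)); rewrite // -val_eqE /= !inordK.
Qed.

End Column.

Lemma not_two_spanning_cyclable4 : 2 < m -> ~ two_spanning_cyclable (HTG m 4 0).
Proof.
move=> m_gt2.
have m_gt0 : 0 < m by lia. have m_gt1 : 1 < m by lia.
pose i0 := Ordinal m_gt0; pose i1 := Ordinal m_gt1; pose i2 := Ordinal m_gt2.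
move/(_ (i0, row4 1) (i1, row4 1) isT) => [f [ef [c1 [c2 [fc uc1 vc2]]]]].
have [f_sym _ f_val] := ef; have [_ _ c12 fE] := fc.
(* In odd rows flat edges go right only from even columns, so there column 0 is matched with column
   1, and not with column [m - 1]. *)
have nbr01 k y : odd k ->
    flat0_edge (i0, k) y || flat0_edge y (i0, k) -> y = (i1, k).
  case: y => i k' k_odd; rewrite /flat0_edge /=.
  case/orP=> [/and3P[/eqP ii /eqP-> _]|/and3P[/eqP ii /eqP kk]].
    by congr pair; apply: val_inj; rewrite /= ii modn_small.
  rewrite -kk oddD k_odd addbT => i_even.
  have [im|mi] := ltnP i.+1 m; first by rewrite modn_small in ii.
  by have := ltn_ord i; move: m_even i_even; lia.
have nbr10 k y : odd k ->
    flat0_edge (i1, k) y || flat0_edge y (i1, k) -> y = (i0, k).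
  case: y => i k' k_odd; rewrite /flat0_edge /= k_odd !andbF /=.
  case/and3P=> /eqP ii /eqP-> _; congr pair; apply: val_inj => /=.
  have [im|mi] := ltnP i.+1 m; first by rewrite modn_small in ii; lia.
  have im : i.+1 = m by have := ltn_ord i; lia.
  by rewrite im modnn in ii.
have nf j : (i0, row4 j) \in c1 -> (i1, row4 j) \in c2 ->
    ~~ f (i0, row4 j) (i1, row4 j).
  move=> c1j c2j; apply/negP=> /(two_cycles_closed1 fc)/(_ c1j) c1j'.
  by rewrite (disjointFr c12 c1j') in c2j.
have nf1 := nf 1 uc1 vc2.
have u3 := unused_flat_column ef nbr01 (two_cycles_closed1 fc) nf1 uc1.
have nf1' : ~~ f (i1, row4 1) (i0, row4 1) by rewrite f_sym.
have v3 := unused_flat_column ef nbr10 (two_cycles_closed2 fc) nf1' vc2.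
have nf3 := nf 3 u3 v3.
have col0 := two_cycles_sub1 fc uc1 (eqxx i0)
  (unused_flats_column ef nbr01 nf1 nf3).
have nf3' : ~~ f (i1, row4 3) (i0, row4 3) by rewrite f_sym.
have col1 := two_cycles_sub1 (two_cyclesC fc) vc2 (eqxx i1)
  (unused_flats_column ef nbr10 nf1' nf3').
(* Positive valency puts this vertex on [c1] or [c2], but these stay in columns 0 and 1. *)
have: 0 < valency f (i2, row4 0) by rewrite f_val.
case/card_gt0P=> y; rewrite inE fE => /orP[] /andP[/= + _].
  by move/col0.
by move/col1.
Qed.

End FourRows.

Theorem theorem5p1 (m n : nat) (hm : 2 <= m) (m_even : ~~ odd m)
    (hn : 4 <= n) (n_even : ~~ odd n) :
  two_spanning_cyclable (HTG m n 0) <-> (4 < n \/ (m, n) = (2, 4)).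
Proof.
have m_gt0 : 0 < m by lia.
have n_gt0 : 0 < n by lia.
split=> [cyc|mn u v uv].
  have [n4|] := ltnP 4 n; [by left|move=> n4; right].
  have nE : n = 4 by lia.
  rewrite nE in cyc *; congr pair.
  have [m2|] := ltnP 2 m; last by lia.
  by case: (not_two_spanning_cyclable4 m_even m2 cyc).
have [m2|m2] := eqVneq m 2; first exact: (separable_prism m_gt0 m_even n_gt0).
case: mn => [n4|[m2' _]]; last by rewrite m2' in m2.
by apply: (separable_ge6 m_gt0 m_even n_gt0) => //; lia.
Qed.
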